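(* Let $G=(\boldsymbol U\cup\boldsymbol X\cup\{Y\},E)$ be a binary linear model with hidden variables of the admissible form described in the context, and let $G'$ be the transformed Markovian model. For any $\boldsymbol S\subseteq\boldsymbol X$ and any value $\boldsymbol s\in\{0,1\}^{|\boldsymbol S|}$, $$\mathbb E[Y\mid do(\boldsymbol S=\boldsymbol s)]=\mathbb E'[Y\mid do(\boldsymbol S=\boldsymbol s)],$$ where $\mathbb E$ and $\mathbb E'$ denote expectations in $G$ and $G'$ respectively.
   Context: **BLM with hidden variables.** $G=(\boldsymbol U\cup\boldsymbol X\cup\{Y\},E)$ is a finite DAG with $\{0,1\}$-valued variables; $\boldsymbol U=\{U_0,U_1,\dots\}$ are hidden, $\boldsymbol X\cup\{Y\}$ observed; $Y$ has no outgoing edges; $U_0\equiv1$ has only outgoing edges (modelling self-activation). For every node $X\neq U_0$ with parents $\mathrm{Pa}(X)$: $P(X=1\mid \mathrm{Pa}(X)=\mathrm{pa}(X))=\boldsymbol\theta^*_X\cdot \mathrm{pa}(X)+\varepsilon_X\in[0,1]$, with $\boldsymbol\theta^*_X\in[0,1]^{|\mathrm{Pa}(X)|}$ and zero-mean sub-Gaussian noises $\varepsilon_X$, mutually independent over nodes. Expectations are taken over noise and variables. $\theta^*_{Z,X}$ is the weight of edge $(Z,X)$. Arbitrary edges involving hidden nodes are allowed, except that the following is excluded: a hidden node $U_s$ with $s>0$ has a directed path to an observed $X_i$ and a directed path to an observed descendant $X_j$ of $X_i$, with all nodes of both paths hidden except the end points $X_i$, $X_j$. $do(\boldsymbol S=\boldsymbol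 s)$ forces the variables in $\boldsymbol S$ to the values $\boldsymbol s$. **Transformed model $G'$.** $G'=(\{X_1\}\cup\boldsymbol X\cup\{Y\},E')$, with $X_1\notin\boldsymbol X\cup\{Y\}$ a new node constantly equal to $1$. A hidden path from observed $X_i$ to observed $X_j$ in $G$ is a directed path all of whose intermediate nodes (if any) are hidden; $\theta^*_P$ is the product of the weights on path $P$. If the set $\mathcal P^u_{X_i,X_j}$ of hidden paths is nonempty, $E'$ contains $(X_i,X_j)$ with weight $\theta^{*\prime}_{X_i,X_j}=\sum_{P\in\mathcal P^u_{X_i,X_j}}\theta^*_P$. For each $X_i\in\boldsymbol X\cup\{Y\}$, $E'$ contains $(X_1,X_i)$ with weight $\theta^{*\prime}_{X_1,X_i}=\Pr\{X_i=1\mid do(\boldsymbol X\cup\{Y\}\setminus\{X_i\}=\boldsymbol0)\}$ (in $G$). The noise variables are carried over without change, and in $G'$, $P'(X=1\mid \mathrm{Pa}'(X)=\mathrm{pa}'(X))=\boldsymbol\theta^{*\prime}_X\cdot \mathrm{pa}'(X)+\varepsilon_X$, where $\mathrm{Pa}'(X)$ is the parent set in $G'$. *)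

(* Defs.v *)
From HB Require Import structures.
From mathcomp Require Import all_boot all_order all_algebra.
From mathcomp Require Import all_classical all_reals all_analysis.

Set Implicit Arguments.
Unset Strict Implicit.
Unset Printing Implicit Defensive.

Import Order.TTheory GRing.Theory Num.Theory.
Import numFieldNormedType.Exports.

Local Open Scope classical_set_scope.
Local Open Scope ring_scope.

Section Noise.
Context {d : measure_display} {T : measurableType d} {R : realType}.
Variable P : probability T R.

Definition mutually_independent (I : finType) (D : {set I})
    (X : I -> {RV P >-> R}) : Prop :=
  forall (J : {set I}) (A : I -> set R),
    J \subset D -> (forall i, measurable (A i)) ->
    P (\bigcap_(i in [set` J]) (X i @^-1` A i)) =
      (\prod_(i in J) P (X i @^-1` A i))%E.

Definition sub_gaussian (X : {RV P >-> R}) : Prop :=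
  exists sigma : R, forall t : R,
    ('M_P X t <= (expR (sigma ^+ 2 * t ^+ 2 / 2))%:E)%E.

End Noise.

Definition acyclic (V : finType) (e : rel V) : Prop :=
  forall a b, e a b -> ~~ connect e b a.

(* [q] lists the intermediate nodes of a directed path from [a] to [b]; they
   are all required to be in [H], whereas nothing is asked of [a] and [b]. *)
Definition hidden_path (V : finType) (e : rel V) (H : {set V})
    (a : V) (q : seq V) (b : V) : bool :=
  path e a (rcons q b) && all (mem H) q.

(* Bounds the number of intermediate nodes, so that sums and existential
   quantifications over [n.-tuple V], [n < #|V|], range over all hidden paths. *)
Lemma hidden_path_size (V : finType) (e : rel V) (H : {set V}) a q b :
  acyclic e -> hidden_path e H a q b -> (size q < #|V|)%N.
Proof.
move=> acy /andP[pq _].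
have pathU : forall s x, path e x s -> uniq (x :: s).
  elim=> [//|y s IHs] x /= /andP[exy ps].
  have /= -> := IHs _ ps; rewrite andbT; apply/negP => xs.
  have /negP := acy _ _ exy; apply.
  by apply/connectP; move: xs ps; case/splitPl => p1 p2 <-;
    rewrite cat_path => /andP[pp1 _]; exists p1.
have /card_uniqP := pathU _ _ pq.
rewrite /= size_rcons => cardE.
by apply: leq_trans (max_card (mem (a :: rcons q b))); rewrite cardE.
Qed.

(* A binary linear model on a finite digraph with a distinguished node [one]
   constantly equal to 1.  The weight [weight a b] and the noise [noise b] are
   relevant only when [edge M a b], resp. [b != one]. *)
Record linear_model {d : measure_display} {T : measurableType d} {R : realType}
    (P : probability T R) := LinearModel {
  node : finType;
  one : node;
  edge : rel node;
  weight : node -> node -> R;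
  noise : node -> {RV P >-> R}
}.

Arguments node {d T R P} M : rename.
Arguments one {d T R P} M : rename.
Arguments edge {d T R P} M : rename.
Arguments weight {d T R P} M : rename.
Arguments noise {d T R P} M : rename.

Section Interventions.
Context {d : measure_display} {T : measurableType d} {R : realType}.
Context {P : probability T R}.
Variable M : linear_model P.

(* P(v = 1 | Pa(v) = x restricted to Pa(v)), for the noise realisation w *)
Definition activation (w : T) (x : {ffun node M -> bool}) (v : node M) : R :=
  \sum_(z | edge M z v) weight M z v * (x z)%:R + noise M v w.

Variables (S : {set node M}) (s : node M -> bool).

(* Probability, under do(S = s) and for the noise realisation [w], that [v]
   takes the value [x v] when its parents take the values given by [x]; only the
   values of [s] on [S] are used. *)
Definition mechanism (w : T) (x : {ffun node M -> bool}) (v : node M) : R :=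
  if v == one M then (x v)%:R
  else if v \in S then (x v == s v)%:R
  else if x v then activation w x v else 1 - activation w x v.

Definition do_pmf (w : T) (x : {ffun node M -> bool}) : R :=
  \prod_v mechanism w x v.

(* The noise is drawn from [P], then the nodes from [do_pmf]. *)
Definition do_prob (E : pred {ffun node M -> bool}) : \bar R :=
  'E_P[fun w => \sum_(x : {ffun node M -> bool} | E x) do_pmf w x].

Definition do_expectation (v : node M) : \bar R :=
  'E_P[fun w => \sum_(x : {ffun node M -> bool}) (x v)%:R * do_pmf w x].

End Interventions.

Arguments do_prob {d T R P} M S s E.
Arguments do_expectation {d T R P} M S s v.

(* [one M] is U_0, [hidden] is U and [target] is Y. *)
Record latent_blm {d : measure_display} {T : measurableType d} {R : realType}
    (P : probability T R) := LatentBLM {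
  model :> linear_model P;
  hidden : {set node model};
  target : node model;
  one_hidden : one model \in hidden;
  target_observed : target \notin hidden;
  edge_acyclic : acyclic (edge model);
  one_source : forall v : node model, ~~ edge model v (one model);
  target_sink : forall v : node model, ~~ edge model target v;
  weight_itv : forall a b : node model, edge model a b -> 0 <= weight model a b <= 1;
  noise_mean0 : forall v : node model, v != one model ->
    ('E_P[noise model v] = 0)%E;
  noise_sub_gaussian : forall v : node model, v != one model ->
    sub_gaussian (noise model v);
  noise_independent :
    mutually_independent (~: [set one model])%SET (noise model);
  activation_itv : forall v : node model, v != one model ->
    {ae P, forall w, forall x : {ffun node model -> bool},
      x (one model) -> 0 <= activation w x v <= 1};
  (* "Descendant" is proper, and [xj] may be [target]. *)
  no_confounder : ~ exists u xi xj : node model,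
    [/\ u \in hidden, u != one model, xi \notin hidden & xj \notin hidden] /\
    [/\ xj != xi, connect (edge model) xi xj,
        exists p, hidden_path (edge model) hidden u p xi
      & exists q, hidden_path (edge model) hidden u q xj]
}.

Section Transformation.
Context {d : measure_display} {T : measurableType d} {R : realType}.
Context {P : probability T R}.
Variable G : latent_blm P.

Definition observed : finType := {v : node G | v \notin hidden G}.

Definition target_obs : observed := exist _ (target G) (target_observed G).

Definition path_weight (a : node G) (q : seq (node G)) (b : node G) : R :=
  \prod_(t <- pairmap (weight G) a (rcons q b)) t.

Definition hidden_link (a b : node G) : bool :=
  [exists n : 'I_#|node G|, exists q : n.-tuple (node G),
    hidden_path (edge G) (hidden G) a q b].

Definition hidden_weight (a b : node G) : R :=
  \sum_(n < #|node G|)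
    \sum_(q : n.-tuple (node G) |
          hidden_path (edge G) (hidden G) a q b)
      path_weight a q b.

(* Pr{v = 1 | do(all other observed nodes = 0)} in G *)
Definition self_weight (v : node G) : R :=
  fine (do_prob G (~: hidden G :\ v)%SET (fun=> false) (fun x => x v)).

(* Nodes of G': [None] is the constant node X_1, [Some v] an observed node. *)
Definition tnode : finType := option observed.

Definition tedge : rel tnode := fun a b =>
  match a, b with
  | _, None => false
  | None, Some _ => true
  | Some a, Some b => hidden_link (val a) (val b)
  end.

Definition tweight (a b : tnode) : R :=
  match a, b with
  | _, None => 0
  | None, Some b => self_weight (val b)
  | Some a, Some b => hidden_weight (val a) (val b)
  end.

(* The node of G underlying a node of G'.  [None] is sent to U_0 so that the map
   is total: constant nodes use no noise, and U_0 is never intervened upon. *)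
Definition tbase (a : tnode) : node G := oapp val (one G) a.

Definition transform : linear_model P :=
  @LinearModel _ _ _ P tnode None tedge tweight (fun a => noise G (tbase a)).

Definition transform_target : node transform := Some target_obs.

End Transformation.

(* Main.v *)
(** For each noise realisation the nodes are drawn from a (possibly signed)
   product of kernels, and the activation of a node is affine in its parents,
   so the mean of a node given the noise is the same affine function of the
   means of its parents.  The noises being centred, the interventional means in
   [G] solve the linear system [mu v = \sum_(z -> v) weight z v * mu z] off the
   intervened nodes.  Eliminating the hidden nodes other than U_0 turns the
   coefficients into sums over hidden paths.  The same elimination under
   do(all other observed nodes = 0) identifies [self_weight v] with the total
   weight of the hidden paths from U_0 to [v], so [transform G] has this very
   system. *)

Require Import Defs.
From mathcomp Require Import all_boot all_order all_algebra.
From mathcomp Require Import all_classical all_reals all_analysis.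
From mathcomp Require Import measurable_realfun ring.

Set Implicit Arguments.
Unset Strict Implicit.
Unset Printing Implicit Defensive.

Import Order.TTheory GRing.Theory Num.Theory.

Local Open Scope ring_scope.

(** * Induction along the edges of a finite acyclic digraph *)

Section Acyclic.
Variables (V : finType) (e : rel V).
Hypothesis e_acyclic : acyclic e.

Lemma acyclic_irrefl v : ~~ e v v.
Proof. by apply/negP => /[dup] /e_acyclic; rewrite connect0. Qed.

(** The number of ancestors drops strictly from a node to its parent: the node is an ancestor of
    itself but, by acyclicity, not of its parent. *)
Lemma acyclic_ind (Q : V -> Prop) :
  (forall v, (forall u, e u v -> Q u) -> Q v) -> forall v, Q v.
Proof.
move=> IH v; pose anc v := [set u | connect e u v]%SET.
have [n] := ubnP #|anc v|; elim: n v => // n IHn v anc_v.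
apply: IH => u euv; apply: IHn; rewrite -ltnS (leq_trans _ anc_v)// ltnS.
apply/proper_card/properP; split; last first.
  by exists v; rewrite !inE ?connect0// e_acyclic.
apply/fintype.subsetP => a; rewrite !inE => /connect_trans; apply.
exact: connect1.
Qed.

Lemma acyclic_minimal (D : {set V}) v :
  v \in D -> exists2 u, u \in D & forall z, e z u -> z \notin D.
Proof.
move: v; apply: acyclic_ind => v IHv vD.
have [/existsP[z /andP[ezv zD]]|/existsPn minv] :=
  boolP [exists z, e z v && (z \in D)]; first exact: IHv ezv zD.
by exists v => // z ezv; have := minv z; rewrite ezv.
Qed.

End Acyclic.

(** * Flipping one coordinate of a boolean configuration *)

Section Flip.
Variable V : finType.
Implicit Types x : {ffun V -> bool}.

Definition flip (u : V) x : {ffun V -> bool} :=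
  [ffun v => if v == u then ~~ x v else x v].

Lemma flipK u : involutive (flip u).
Proof.
by move=> x; apply/ffunP => v; rewrite !ffunE; case: eqP; rewrite ?negbK.
Qed.

Lemma flip_eq u x : flip u x u = ~~ x u.
Proof. by rewrite ffunE eqxx. Qed.

Lemma flip_neq u v x : v != u -> flip u x v = x v.
Proof. by rewrite ffunE => /negPf->. Qed.

(** Isolates the summation over the value of [u]: doubling pairs each configuration with its flip,
    so no splitting by the value of [u] is needed. *)
Lemma sum_flip (W : nmodType) u (F : {ffun V -> bool} -> W) :
  (\sum_x F x) *+ 2 = \sum_x (F x + F (flip u x)).
Proof.
rewrite big_split mulr2n; congr (_ + _).
exact: (reindex_inj (inv_inj (flipK u))).
Qed.

End Flip.

(** * Total mass and means of a signed product of local kernels *)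

Section BooleanNetwork.
Variables (R : numFieldType) (V : finType) (e : rel V).
Hypothesis e_acyclic : acyclic e.
(* [k x v] plays the role of P(v = 1 | x), but need not lie in [0, 1]: the
   product of the factors [node_weight x v] is a signed measure. *)
Variable k : {ffun V -> bool} -> V -> R.
Hypothesis k_local : forall x u v, ~~ e u v -> k (flip u x) v = k x v.
Implicit Types (x : {ffun V -> bool}) (F : {ffun V -> bool} -> R).

Definition node_weight x v : R := if x v then k x v else 1 - k x v.

Lemma node_weight_flip x u v :
  v != u -> ~~ e u v -> node_weight (flip u x) v = node_weight x v.
Proof. by move=> vu euv; rewrite /node_weight flip_neq// k_local. Qed.

Lemma node_weightD x u : node_weight x u + node_weight (flip u x) u = 1.
Proof.
rewrite /node_weight flip_eq k_local ?acyclic_irrefl//.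
by case: (x u) => /=; ring.
Qed.

Lemma prod_node_weight_flip (D : {set V}) x u :
  u \in D -> (forall z, e u z -> z \in D) ->
  \prod_(v in ~: D) node_weight (flip u x) v =
  \prod_(v in ~: D) node_weight x v.
Proof.
move=> uD eD; apply: eq_bigr => v; rewrite inE => vD.
rewrite node_weight_flip//; first by apply: contraNneq vD => ->.
by apply: contraNN vD => /eD.
Qed.

Lemma prod_node_weight_D1 (D : {set V}) x u : u \in D ->
  \prod_(v in ~: (D :\ u)) node_weight x v =
  node_weight x u * \prod_(v in ~: D) node_weight x v.
Proof.
move=> uD; rewrite (bigD1 u) ?inE ?eqxx//=; congr (_ * _); apply: eq_bigl => v.
by rewrite !inE; case: eqVneq => [->|]; rewrite ?uD ?andbF ?andbT.
Qed.

(* When no parent of u is in D, summing over the value of u replaces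
   [node_weight x u] by 1; the other factors are left unchanged by the flip of u
   because the children of u have been removed already. *)
Lemma sum_peel (D : {set V}) F :
  (forall u z, u \in D -> e u z -> z \in D) ->
  (forall u x, u \in D -> F (flip u x) = F x) ->
  (\sum_x F x * \prod_v node_weight x v) *+ 2 ^ #|D| =
  \sum_x F x * \prod_(v in ~: D) node_weight x v.
Proof.
have [n] := ubnP #|D|; elim: n D => // n IHn D Dn Dcl DF.
have [->|[u0 u0D]] := set_0Vmem D.
  rewrite cards0 mulr1n finset.setC0; apply: eq_bigr => x _; congr (_ * _).
  by apply: eq_bigl => v; rewrite inE.
have [u uD minu] := acyclic_minimal e_acyclic u0D.
have cardD := cardsD1 u D; rewrite uD add1n in cardD.
rewrite cardD expnSr mulrnA IHn; first last.
- by move=> v x /setD1P[_]; exact: DF.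
- move=> v z /setD1P[_ vD] evz; rewrite !inE (Dcl _ _ vD evz) andbT.
  by apply: contraTneq vD => zu; apply: minu; rewrite -zu.
- by rewrite -ltnS -cardD.
rewrite (sum_flip u); apply: eq_bigr => x _.
rewrite !prod_node_weight_D1// DF// prod_node_weight_flip//; last first.
  by move=> z; exact: Dcl.
by rewrite -mulrDr -mulrDl node_weightD mul1r.
Qed.

Lemma sum_node_weight : \sum_x \prod_v node_weight x v = 1.
Proof.
(* Peeling every node leaves 1 for each of the [2 ^ #|V|] configurations, which cancels the factor
   [2 ^ #|V|] on the left. *)
have := @sum_peel [set: V]%SET (fun=> 1)
  (fun _ z _ _ => finset.in_setT z) (fun _ _ _ => erefl).
under eq_bigr do rewrite mul1r.
under [in RHS]eq_bigr do rewrite finset.setCT big_set0 mulr1.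
rewrite sumr_const card_ffun card_bool cardsT -[LHS]mulr_natr -[RHS]mulr_natr.
by move/mulIf; apply; rewrite pnatr_eq0 expn_eq0.
Qed.

(** The difference [x v - k x v] has mean zero once all nodes but [v] and its non-descendants are
    summed out: the two values of [v] contribute [(1 - k) * k] and [- k * (1 - k)]. *)
Lemma mean_node_weight v :
  \sum_(x : {ffun V -> bool}) (x v)%:R * \prod_u node_weight x u =
  \sum_x k x v * \prod_u node_weight x u.
Proof.
apply/eqP; rewrite -subr_eq0 -sumrB; under eq_bigr do rewrite -mulrBl.
pose D := [set u | connect e v u]%SET.
have vD : v \in D by rewrite inE connect0.
have Dcl u z : u \in D -> e u z -> z \in D.
  by rewrite !inE => vu /connect1; exact: connect_trans.
(* No descendant of [v] is a parent of [v], so [D :\ v] is closed under children and [k x v] does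
   not see it. *)
have Dv u : u \in D -> ~~ e u v.
  by rewrite inE; apply: contraTN; exact: e_acyclic.
set Z := \sum_x _; suff : Z *+ 2 ^ #|D :\ v|%SET *+ 2 == 0.
  by rewrite -mulrnA -mulr_natr mulf_eq0 pnatr_eq0 muln_eq0 expn_eq0 orbF.
rewrite (@sum_peel (D :\ v) (fun x => (x v)%:R - k x v)); first last.
- by move=> u x /setD1P[uv uD]; rewrite flip_neq 1?eq_sym// k_local// Dv.
- move=> u z /setD1P[_ uD] euz; rewrite in_setD1.
  have := Dcl _ _ uD euz; rewrite inE => ->; rewrite andbT.
  by apply: contraTneq euz => ->; exact: Dv.
rewrite (sum_flip v) big1// => x _; rewrite !prod_node_weight_D1//.
rewrite prod_node_weight_flip//; last by move=> z; exact: Dcl.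
rewrite !mulrA -mulrDl /node_weight flip_eq k_local ?Dv//.
by case: (x v) => /=; ring.
Qed.

End BooleanNetwork.

(** * The linear system satisfied by the interventional means *)

Section LinearModel.
Context {d : measure_display} {T : measurableType d} {R : realType}.
Context {P : probability T R}.

(** The expectation is a difference of two nonnegative integrals; it is finite only if both are. *)
Lemma integrable_mean0 (X : {RV P >-> R}) :
  ('E_P[X] = 0)%E -> P.-integrable [set: T] (EFin \o X).
Proof.
move=> X0; have /measurable_EFinP mX := measurable_funPT X.
have : ('E_P[X] \is a fin_num)%E by rewrite X0.
rewrite unlock integralE fin_numB => /andP[fp fn].
apply/integrableP; split=> //.
have -> : (fun x => `|(EFin \o X) x|)%E =
    (fun x => (EFin \o X)^\+ x + (EFin \o X)^\- x)%E.
  exact: (fune_abse (EFin \o X)).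
rewrite ge0_integralD//; [|exact: measurable_funepos|exact: measurable_funeneg].
by rewrite lte_add_pinfty// -ge0_fin_numE// integral_ge0.
Qed.

Variable M : linear_model P.
Hypothesis M_acyclic : acyclic (edge M).
Hypothesis noise0 : forall v, v != Defs.one M -> ('E_P[noise M v] = 0)%E.
Variables (S : {set node M}) (s : node M -> bool).

Definition cond_mean (w : T) (v : node M) : R :=
  \sum_(x : {ffun node M -> bool}) (x v)%:R * do_pmf S s w x.

Lemma cond_meanE w v : cond_mean w v =
  if v == Defs.one M then 1 else if v \in S then (s v)%:R
  else \sum_(z | edge M z v) weight M z v * cond_mean w z + noise M v w.
Proof.
(* The constant node and the intervened nodes get constant kernels with value 0 or 1, so that
   [do_pmf] becomes a product of [node_weight]. *)
pose k x v := if v == Defs.one M then 1 else if v \in S then (s v)%:R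
  else activation w x v.
have kl x u t : ~~ edge M u t -> k (flip u x) t = k x t.
  rewrite /k => ut; case: ifP => // _; case: ifP => // _; congr (_ + _).
  apply: eq_bigr => z zt; rewrite flip_neq//.
  by apply: contraNneq ut => <-.
have pmfE x : do_pmf S s w x = \prod_u node_weight k x u.
  apply: eq_bigr => u _; rewrite /mechanism /node_weight /k.
  case: (u == _); first by case: (x u) => //=; rewrite subrr.
  by case: (u \in S) => //; case: (x u); case: (s u); rewrite /= ?subr0 ?subrr.
have k1 := sum_node_weight M_acyclic kl.
rewrite /cond_mean; under eq_bigr do rewrite pmfE.
rewrite (mean_node_weight M_acyclic kl) {1}/k.
case: ifP => _; first by under eq_bigr do rewrite mul1r.
case: ifP => _; first by rewrite -mulr_sumr k1 mulr1.
under eq_bigr do rewrite mulrDl mulr_suml.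
rewrite big_split/= -mulr_sumr k1 mulr1; congr (_ + _).
rewrite exchange_big; apply: eq_bigr => z _; rewrite mulr_sumr.
by apply: eq_bigr => x _; rewrite pmfE mulrA.
Qed.

Lemma integrable_cond_mean v :
  P.-integrable [set: T] (fun w => (cond_mean w v)%:E).
Proof.
move: v; apply: (acyclic_ind M_acyclic) => v IHv.
under eq_fun do rewrite cond_meanE.
case: eqVneq => [_|v1]; first exact: finite_measure_integrable_cst.
case: (v \in S); first exact: finite_measure_integrable_cst.
under eq_fun do rewrite EFinD -sumEFin.
apply: integrableD => //; last exact/integrable_mean0/noise0.
apply: integrable_sum => // z zv; under eq_fun do rewrite EFinM.
by apply: integrableZl => //; exact: IHv.
Qed.

(** Nothing is lost by [fine] for an acyclic model with centred noise, since the expectation is then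
    finite. *)
Definition do_mean v : R := fine (do_expectation M S s v).

Lemma do_expectationE v : do_expectation M S s v = (do_mean v)%:E.
Proof.
rewrite /do_mean fineK// /do_expectation unlock.
exact/integrable_fin_num/integrable_cond_mean.
Qed.

Lemma do_meanE v : do_mean v =
  if v == Defs.one M then 1 else if v \in S then (s v)%:R
  else \sum_(z | edge M z v) weight M z v * do_mean z.
Proof.
apply: EFin_inj; rewrite -do_expectationE.
transitivity 'E_P[fun w => cond_mean w v]%E; first by [].
under eq_fun do rewrite cond_meanE.
case: eqVneq => [_|v1]; first exact: expectation_cst.
case: (v \in S); first exact: expectation_cst.
have iM z : P.-integrable [set: T]
    (fun w => (weight M z v)%:E * (cond_mean w z)%:E)%E.
  by apply: integrableZl => //; exact: integrable_cond_mean.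
rewrite unlock; under eq_integral do rewrite EFinD -sumEFin.
rewrite integralD//; last first.
- exact/integrable_mean0/noise0.
- by apply: integrable_sum => // z _; exact: iM.
rewrite -expectation_def noise0// adde0.
rewrite integral_sum// -sumEFin; apply: eq_bigr => z _.
under eq_integral do rewrite EFinM.
rewrite integralZl//; last exact: integrable_cond_mean.
by rewrite EFinM -do_expectationE /do_expectation unlock.
Qed.

End LinearModel.

Lemma do_probE d (T : measurableType d) (R : realType) (P : probability T R)
    (M : linear_model P) (S : {set node M}) (s : node M -> bool) (v : node M) :
  do_prob M S s (fun x => x v) = do_expectation M S s v.
Proof.
rewrite /do_prob /do_expectation; congr expectation; apply/funext => w.
rewrite big_mkcond; apply: eq_bigr => x _.
by case: (x v); rewrite ?mul1r ?mul0r.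
Qed.

(** * Hidden-path weights and the elimination of hidden nodes *)

Section HiddenPaths.
Context {d : measure_display} {T : measurableType d} {R : realType}.
Context {P : probability T R}.
Variable G : latent_blm P.

Let acyG : acyclic (edge G) := @edge_acyclic _ _ _ _ G.

Definition hidden_weightn n (a b : node G) : R :=
  \sum_(q : n.-tuple (node G) | hidden_path (edge G) (hidden G) a q b)
    path_weight a q b.

Lemma hidden_weight0 (a b : node G) :
  hidden_weightn 0 a b = if edge G a b then weight G a b else 0.
Proof.
rewrite /hidden_weightn big_mkcond (big_pred1 [tuple]) => [|q]; last first.
  by apply/esym/eqP/val_inj; case: q => -[].
by rewrite /hidden_path /path_weight /= !andbT big_seq1.
Qed.

Lemma hidden_weightSl n (a b : node G) : hidden_weightn n.+1 a b =
  \sum_(h | edge G a h && (h \in hidden G)) weight G a h * hidden_weightn n h b.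
Proof.
rewrite /hidden_weightn; under [RHS]eq_bigr do rewrite mulr_sumr.
rewrite pair_big_dep/=.
rewrite (reindex (fun p : node G * n.-tuple (node G) => [tuple of p.1 :: p.2])).
  apply: eq_big => [[h q]|[h q] _]; last by rewrite /path_weight /= big_cons.
  rewrite /hidden_path/=; case: (edge G a h) => //=.
  by case: (h \in hidden G); rewrite ?andbF.
exists (fun q : n.+1.-tuple (node G) => (thead q, [tuple of behead q])) =>
  [[h q] _|q _].
  by congr (_, _); apply: val_inj.
by rewrite [RHS]tuple_eta.
Qed.

(** Elimination replaces parents of the end point, so the last intermediate node has to be split
    off, whereas tuples are built from the first one; induction on [n] passes from one side to the
    other. *)
Lemma hidden_weightSr n (a b : node G) : hidden_weightn n.+1 a b =
  \sum_(h | (h \in hidden G) && edge G h b) hidden_weightn n a h * weight G h b.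
Proof.
elim: n a => [|n IHn] a; rewrite hidden_weightSl.
  rewrite big_mkcond [RHS]big_mkcond; apply: eq_bigr => h _.
  rewrite !hidden_weight0; case: (edge G a h); case: (h \in hidden G) => //=.
    by case: ifP; rewrite ?mulr0.
  by case: ifP; rewrite ?mul0r.
under eq_bigr do rewrite IHn mulr_sumr.
rewrite exchange_big; apply: eq_bigr => h _.
by rewrite hidden_weightSl mulr_suml; apply: eq_bigr => z _; rewrite mulrA.
Qed.

Lemma hidden_weightE (a b : node G) : hidden_weight a b =
  (if edge G a b then weight G a b else 0) +
  \sum_(h | (h \in hidden G) && edge G h b) hidden_weight a h * weight G h b.
Proof.
(* Splitting off a node shifts the length by one; acyclicity makes the extra top layer empty. *)
have N0 : hidden_weightn #|node G| a b = 0.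
  rewrite /hidden_weightn big_pred0// => q; apply/negP => /hidden_path_size.
  by move=> /(_ acyG); rewrite size_tuple ltnn.
transitivity (\sum_(n < #|node G|.+1) hidden_weightn n a b).
  by rewrite big_ord_recr/= N0 addr0.
rewrite big_ord_recl hidden_weight0; congr (_ + _).
under eq_bigr do rewrite hidden_weightSr.
by rewrite exchange_big; apply: eq_bigr => h _; rewrite mulr_suml.
Qed.

Lemma hidden_weight_eq0 (a b : node G) :
  ~~ hidden_link a b -> hidden_weight a b = 0.
Proof.
move=> /existsPn noq; rewrite /hidden_weight big1// => n _.
by rewrite big_pred0// => q; apply/negbTE; have /existsPn := noq n; apply.
Qed.

Lemma hidden_link_edge (a b : node G) :
  hidden_link a b -> exists2 c, connect (edge G) a c & edge G c b.
Proof.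
move=> /existsP[n /existsP[q /andP[]]]; rewrite rcons_path => /andP[aq qb] _.
by exists (last a q) => //; apply/connectP; exists q.
Qed.

Lemma hidden_link_acyclic (a b : node G) :
  hidden_link a b -> ~~ connect (edge G) b a.
Proof.
move=> /hidden_link_edge[c ac cb]; apply: contraNN (acyG cb) => ba.
exact: connect_trans ac.
Qed.

Lemma hidden_weight_refl (a : node G) : hidden_weight a a = 0.
Proof.
apply: hidden_weight_eq0; apply/negP => /hidden_link_acyclic.
by rewrite connect0.
Qed.

Lemma hidden_weight_to_one (a : node G) : hidden_weight a (Defs.one G) = 0.
Proof.
apply: hidden_weight_eq0; apply/negP => /hidden_link_edge[c _].
exact/negP/one_source.
Qed.

(** Parents that are observed or [one] give the paths without intermediate node. Any other parent is
    hidden, hence not intervened upon, and the induction hypothesis expands its mean;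
    [hidden_weightE] reassembles the pieces. *)
Lemma do_mean_hidden_paths (S : {set node G}) (s : node G -> bool) v :
  S \subset (~: hidden G)%SET -> v != Defs.one G -> v \notin S ->
  do_mean S s v =
  \sum_(a | (a \notin hidden G) || (a == Defs.one G))
    hidden_weight a v * do_mean S s a.
Proof.
move=> S_obs; move: v; apply: (acyclic_ind acyG) => v IHv v1 vS.
pose B (a : node G) := (a \notin hidden G) || (a == Defs.one G).
rewrite (do_meanE acyG (@noise_mean0 _ _ _ _ G)) (negPf v1) (negPf vS).
under [RHS]eq_bigr do rewrite hidden_weightE mulrDl mulr_suml.
rewrite (bigID B)/= big_split/=; congr (_ + _).
  rewrite big_mkcond [RHS]big_mkcond; apply: eq_bigr => a _; rewrite -/(B a).
  by case: (B a); rewrite ?andbT ?andbF//; case: ifP; rewrite ?mul0r.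
(* [one] is hidden and so occurs as a last intermediate node in [hidden_weightE], but it has no
   incoming edge and its term vanishes. *)
rewrite exchange_big/= [RHS](bigID (pred1 (Defs.one G)))/=.
rewrite [X in _ = X + _]big1 ?add0r; last first.
  move=> h /andP[_ /eqP->]; rewrite big1// => a _.
  by rewrite hidden_weight_to_one !mul0r.
apply: eq_big => [h|h /andP[hv]]; first by rewrite negb_or negbK andbCA andbA.
rewrite negb_or negbK => /andP[h_hid h1].
rewrite IHv//; last first.
  by apply: contraTN h_hid => /(fintype.subsetP S_obs); rewrite inE.
by rewrite mulr_sumr; apply: eq_bigr => a _; rewrite mulrCA mulrA.
Qed.

(** * The transformed model and its linear system *)

Lemma observed_neq_one (v : observed G) : val v != Defs.one G.
Proof. by apply: contraNneq (valP v) => ->; rewrite one_hidden. Qed.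

(** Among the sources of hidden paths, the other observed nodes are forced to 0 and [v] has no
    hidden path to itself, so only [one], of mean 1, contributes. *)
Lemma self_weightE (v : observed G) :
  self_weight (val v) = hidden_weight (Defs.one G) (val v).
Proof.
rewrite /self_weight do_probE -[fine _]/(do_mean _ _ _).
set S := (_ :\ _)%SET; have n0 := @noise_mean0 _ _ _ _ G.
rewrite do_mean_hidden_paths ?observed_neq_one//; first last.
- by rewrite !inE eqxx.
- exact: subD1set.
rewrite (bigD1 (Defs.one G)) ?eqxx ?orbT//= (do_meanE acyG n0) eqxx mulr1.
rewrite big1 ?addr0// => a /andP[aB a1]; rewrite (negPf a1) orbF in aB.
have [->|av] := eqVneq a (val v); first by rewrite hidden_weight_refl mul0r.
by rewrite (do_meanE acyG n0) (negPf a1) !inE av aB mulr0.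
Qed.

(** No edge enters [None], and each edge between observed nodes unfolds to a path of [G]; this
    carries acyclicity over to [transform G]. *)
Lemma connect_transform (v : observed G) (t : node (transform G)) :
  connect (edge (transform G)) (Some v) t ->
  exists2 u, t = Some u & connect (edge G) (val v) (val u).
Proof.
move=> /connectP[p]; elim: p v => [|[u|] p IHp] v //=.
- by move=> _ ->; exists v.
- move=> /andP[/hidden_link_edge[c vc cu] up] tE.
  have [u' -> uu'] := IHp _ up tE; exists u' => //.
  exact: connect_trans vc (connect_trans (connect1 cu) uu').
Qed.

Lemma transform_acyclic : acyclic (edge (transform G)).
Proof.
move=> a [b|]; last by case: a.
move=> ab; apply/negP => /connect_transform[u aE bu]; move: ab.
by rewrite aE => /hidden_link_acyclic; rewrite bu.
Qed.

Lemma transform_noise_mean0 (t : node (transform G)) :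
  t != Defs.one (transform G) -> ('E_P[noise (transform G) t] = 0)%E.
Proof. by case: t => // v _; apply: noise_mean0; exact: observed_neq_one. Qed.

(** [tbase] is a bijection from the nodes of the transformed model onto the nodes that survive the
    elimination. *)
Lemma sum_tbase (W : nmodType) (F : node G -> W) :
  \sum_(a | (a \notin hidden G) || (a == Defs.one G)) F a =
  \sum_(t : tnode G) F (tbase t).
Proof.
rewrite (reindex_omap (@tbase _ _ _ _ G)
  (fun a => if a == Defs.one G then Some None else omap Some (insub a)));
  last first.
  move=> a; case: eqVneq => [->//|_]; rewrite orbF => a_obs.
  by rewrite insubT.
apply: eq_bigl => -[v|]; rewrite /= ?eqxx ?orbT//.
by rewrite (valP v) (negPf (observed_neq_one v)) valK/= eqxx.
Qed.

Lemma do_mean_transform (S : {set node G}) (s : node G -> bool)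
    (t : node (transform G)) :
  S \subset (~: hidden G)%SET ->
  do_mean [set a : node (transform G) | tbase a \in S]%SET
    (fun a : node (transform G) => s (tbase a)) t = do_mean S s (tbase t).
Proof.
move=> S_obs; have n0 := @noise_mean0 _ _ _ _ G.
move: t; apply: (acyclic_ind transform_acyclic) => -[v|] IHt; last first.
  rewrite (do_meanE transform_acyclic transform_noise_mean0).
  by rewrite (do_meanE acyG n0) !eqxx.
rewrite (do_meanE transform_acyclic transform_noise_mean0)/= inE.
case: ifP => vS.
  by rewrite (do_meanE acyG n0) (negPf (observed_neq_one v)) vS.
rewrite do_mean_hidden_paths ?observed_neq_one ?vS// sum_tbase.
(* A source without an edge to [v] has hidden weight 0; [None] always has one, with weight given by
   [self_weightE]. *)
rewrite big_mkcond; apply: eq_bigr => t _; case: ifPn => [tv|].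
  rewrite IHt//; congr (_ * _).
  by case: t tv => [//|] _; exact: self_weightE.
by case: t => // u /hidden_weight_eq0 ->; rewrite mul0r.
Qed.

End HiddenPaths.

Theorem lemma4 (d : measure_display) (T : measurableType d) (R : realType)
    (P : probability T R) (G : latent_blm P)
    (S : {set node G}) (hS : S \subset (~: hidden G :\ target G)%SET)
    (s : node G -> bool) :
  do_expectation G S s (target G) =
  do_expectation (transform G) [set a : node (transform G) | tbase a \in S]%SET
    (fun a => s (tbase a)) (transform_target G).
Proof.
rewrite (do_expectationE (@edge_acyclic _ _ _ _ G) (@noise_mean0 _ _ _ _ G)).
rewrite (do_expectationE (@transform_acyclic _ _ _ _ G)
  (@transform_noise_mean0 _ _ _ _ G)).
by rewrite do_mean_transform// (fintype.subset_trans hS)// subD1set.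
Qed.
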